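(* Let $n\ge1$ be an integer and $L\in\mathbb{R}$. On $\mathbb{H}^n$ let $$v=\Big(\sum_{j=1}^{2n}x_j^2\Big)-4iz,\qquad w=\Big(\sum_{j=1}^{2n}x_j^2\Big)+4iz,\qquad u=u_{\infty,L}=v^{\frac{1-L}{4}}w^{\frac{1+L}{4}}.$$ Let $\Upsilon_k=X_ku+iLX_{n+k}u$ for $1\le k\le n$, $\Upsilon_k=X_ku-iLX_{k-n}u$ for $n+1\le k\le2n$, and $\|\Upsilon\|^2=\sum_{j=1}^{2n}\Upsilon_j\overline{\Upsilon_j}$. Then $u_{\infty,L}$ is a smooth solution of the Dirichlet problem $$\overline{\Delta_\infty}u_{\infty,L}:=\sum_{j=1}^{2n}\big(X_j\|\Upsilon\|^2\big)\Upsilon_j=0\ \text{ in }\mathbb{H}^n\setminus\{0\},\qquad u_{\infty,L}=0\ \text{ at }0,$$ i.e. $u_{\infty,L}$ is smooth and satisfies the equation on $\mathbb{H}^n\setminus\{0\}$, and $u_{\infty,L}(q)\to0$ as $q\to0$.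
   Context: $\mathbb{H}^n$ is $\mathbb{R}^{2n+1}$ with coordinates $(x_1,\dots,x_{2n},z)$ and the vector fields $X_i=\frac{\partial}{\partial x_i}-\frac{x_{n+i}}{2}\frac{\partial}{\partial z}$ for $1\le i\le n$ and $X_i=\frac{\partial}{\partial x_i}+\frac{x_{i-n}}{2}\frac{\partial}{\partial z}$ for $n<i\le2n$. Complex powers of $v$ and $w=\overline v$ are taken with the principal branch (both have nonnegative real part and vanish only at the origin). *)

(* Defs.v *)
From HB Require Import structures.
From mathcomp Require Import all_boot all_order all_algebra.
From mathcomp Require Import all_classical all_reals all_analysis.
From mathcomp Require Import complex.
Import Order.TTheory GRing.Theory Num.Theory.
Import numFieldNormedType.Exports.

Set Implicit Arguments.
Unset Strict Implicit.
Unset Printing Implicit Defensive.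

Local Open Scope classical_set_scope.
Local Open Scope ring_scope.
Local Open Scope complex_scope.

Local Notation Re := complex.Re.
Local Notation Im := complex.Im.
Local Notation normc := Normc.normc.

Section ComplexPowers.
Variable R : realType.

(* The argument in ]-pi, pi], for z != 0. *)
Definition carg (z : R[i]) : R :=
  let t := acos (Re z / normc z) in if 0 <= Im z then t else - t.

Definition clog (z : R[i]) : R[i] := ln (normc z) +i* carg z.

Definition cexp (z : R[i]) : R[i] :=
  (expR (Re z))%:C * (cos (Im z) +i* sin (Im z)).

(* As for powR, the value at z = 0 is 1 if a = 0 and 0 otherwise. *)
Definition cpow (z a : R[i]) : R[i] :=
  if z == 0 then (a == 0)%:R else cexp (a * clog z).

End ComplexPowers.

Section Smooth.
Variables (R : realType) (m : nat).
Implicit Types (f : 'rV[R]_m -> R) (U : set 'rV[R]_m).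

Definition partial (i : 'I_m) f : 'rV[R]_m -> R :=
  fun q => 'D_(delta_mx 0 i) f q.

Definition iter_partial (s : seq 'I_m) f : 'rV[R]_m -> R := foldr partial f s.

(* C^infinity on U (meant for open U): the iterated partial derivatives of all
   orders, f itself included, exist and are continuous at every point of U. *)
Definition smooth_on U f : Prop :=
  forall (s : seq 'I_m) (q : 'rV[R]_m), U q ->
    {for q, continuous (iter_partial s f)} /\
    forall i : 'I_m, derivable (iter_partial s f) q (delta_mx 0 i).

Definition csmooth_on U (f : 'rV[R]_m -> R[i]) : Prop :=
  smooth_on U (fun q => Re (f q)) /\ smooth_on U (fun q => Im (f q)).

(* Partial derivative of a complex-valued function of real variables. *)
Definition cpartial (i : 'I_m) (f : 'rV[R]_m -> R[i]) : 'rV[R]_m -> R[i] :=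
  fun q => partial i (fun p => Re (f p)) q +i* partial i (fun p => Im (f p)) q.

End Smooth.

Section Heisenberg.
Variables (R : realType) (n : nat).

(* Points (x_1, ..., x_2n, z) of the Heisenberg group.  The coordinates x_1,
   ..., x_n are indexed by the left summand of n + n, and x_(n+1), ..., x_2n by
   the right one. *)
Definition heis := 'rV[R]_(n + n + 1).

Definition xidx (j : 'I_(n + n)) : 'I_(n + n + 1) := lshift 1 j.
Definition zidx : 'I_(n + n + 1) := rshift (n + n) ord0.

Definition xcoord (q : heis) (j : 'I_(n + n)) : R := q 0 (xidx j).
Definition zcoord (q : heis) : R := q 0 zidx.

Definition heisX (j : 'I_(n + n)) (f : heis -> R[i]) (q : heis) : R[i] :=
  match fintype.split j with
  | inl k => cpartial (xidx j) f q
             - (xcoord q (rshift n k) / 2)%:C * cpartial zidx f q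
  | inr k => cpartial (xidx j) f q
             + (xcoord q (lshift n k) / 2)%:C * cpartial zidx f q
  end.

Definition heis_v (q : heis) : R[i] :=
  (\sum_(j < n + n) xcoord q j ^+ 2)%:C - 4 * 'i * (zcoord q)%:C.

Definition heis_w (q : heis) : R[i] :=
  (\sum_(j < n + n) xcoord q j ^+ 2)%:C + 4 * 'i * (zcoord q)%:C.

Definition u_infty (L : R) (q : heis) : R[i] :=
  cpow (heis_v q) ((1 - L) / 4)%:C * cpow (heis_w q) ((1 + L) / 4)%:C.

Definition Upsilon (L : R) (f : heis -> R[i]) (j : 'I_(n + n)) (q : heis) :
    R[i] :=
  match fintype.split j with
  | inl k => heisX j f q + 'i * L%:C * heisX (rshift n k) f q
  | inr k => heisX j f q - 'i * L%:C * heisX (lshift n k) f q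
  end.

(* ||Upsilon||^2, kept complex-valued. *)
Definition sqnorm_Upsilon (L : R) (f : heis -> R[i]) (q : heis) : R[i] :=
  \sum_(j < n + n) Upsilon L f j q * (Upsilon L f j q)^*.

Definition Delta_infty (L : R) (f : heis -> R[i]) (q : heis) : R[i] :=
  \sum_(j < n + n) heisX j (sqnorm_Upsilon L f) q * Upsilon L f j q.

End Heisenberg.

(* Main.v *)
Require Import Defs.
From HB Require Import structures.
From mathcomp Require Import all_boot all_order all_algebra.
From mathcomp Require Import all_classical all_reals all_analysis.
From mathcomp Require Import complex ring lra.
Import Order.TTheory GRing.Theory Num.Theory.
Import numFieldNormedType.Exports.

Set Implicit Arguments.
Unset Strict Implicit.
Unset Printing Implicit Defensive.

Local Open Scope classical_set_scope.
Local Open Scope ring_scope.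

(** Write r = |x|^2 and N = |v| = |w| = sqrt (r^2 + 16 z^2). The real part r of
    w is nonnegative and vanishes together with z only at the origin, so away
    from the origin arg w = 2 atan (4 z / (N + r)) and arg v = - arg w with no
    branch to cross. As (1 - L) / 4 + (1 + L) / 4 = 1 / 2, the two powers combine
    into u = sqrt N exp (i L theta) with theta = atan (4 z / (N + r))
    ([carg_half], [u_inftyE]).

    Smoothness. Every directional derivative of ln N / 2 and of L theta is a
    polynomial in the coordinates divided by N^2. Hence the algebra of functions
    generated by the constants, the coordinates, N^-2, Re u and Im u is closed
    under partial derivatives ([ualg_derive]) and made of functions that are
    continuous off the origin; all its members are therefore smooth there
    ([smooth_on_closed]).

    Equation. Put p_k + i s_k = w (x_k + i x_(n+k)). The logarithmic derivatives
    of u are X_k u / u = (p_k - i L s_k) / N^2 and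
    X_(n+k) u / u = (s_k + i L p_k) / N^2, and in Upsilon the cross terms cancel:
    Upsilon_k = (1 - L^2) p_k u / N^2 and
    Upsilon_(n+k) = (1 - L^2) s_k u / N^2. Since p_k^2 + s_k^2 =
    (x_k^2 + x_(n+k)^2) N^2 and |u|^2 = N, this gives
    ||Upsilon||^2 = (1 - L^2)^2 r / N ([sqnorm_Upsilon_u]). Finally
    X_k (r / N) = 8 z s_k / N^3 and X_(n+k) (r / N) = - 8 z p_k / N^3, so the
    horizontal gradient of ||Upsilon||^2 is orthogonal to (p_k, s_k) in each
    plane (x_k, x_(n+k)), and the sum defining the operator vanishes pair by pair
    ([Delta_infty_u]).

    Boundary value. |u| = sqrt N is continuous and N = 0 at the origin. *)

(** * Directional derivatives and smoothness *)

(** Reduces directional derivatives to derivatives of functions of one real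
    variable, where the chain rule is available. *)
Lemma is_derive_line (R : realType) (V W : normedModType R) (f : V -> W)
    (q v : V) (d : W) :
  is_derive q v f d <-> is_derive (0 : R) 1 (fun h => f (h *: v + q)) d.
Proof.
have E : (fun h : R => h^-1 *: (((fun h => f (h *: v + q)) \o shift 0) (h *: 1)
            - f (0 *: v + q)))
         = (fun h : R => h^-1 *: ((f \o shift q) (h *: v) - f q)).
  apply/funext => h /=; congr (_ *: (f (_ + _) - f _)).
  - by rewrite addr0 [h *: 1]mulr1.
  - by rewrite scale0r add0r.
by split => -[df dv]; constructor; move: df dv; rewrite /derivable /derive E.
Qed.

Section PointwiseRules.
Variables (R : realType) (V : normedModType R).
Implicit Types (f g : V -> R) (q v : V).

(** Rules for functions written as expressions in the point: unlike the versions
    about sums and products of functions, they compute the derivative of such an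
    expression by unification. *)
Lemma is_deriveD_pt f g q v (a b : R) : is_derive q v f a ->
  is_derive q v g b -> is_derive q v (fun p => f p + g p) (a + b).
Proof. exact: is_deriveD. Qed.

Lemma is_deriveM_pt f g q v (a b : R) : is_derive q v f a ->
  is_derive q v g b -> is_derive q v (fun p => f p * g p) (f q * b + g q * a).
Proof. exact: is_deriveM. Qed.

Lemma is_deriveMl_pt (c : R) f q v (a : R) :
  is_derive q v f a -> is_derive q v (fun p => c * f p) (c * a).
Proof. exact: is_deriveZ. Qed.

Lemma is_deriveV_pt f q v (a : R) : f q != 0 -> is_derive q v f a ->
  is_derive q v (fun p => (f p)^-1) (- a / f q ^+ 2).
Proof.
move=> f0 [df <-]; constructor; first exact: derivableV.
by rewrite deriveV// /GRing.scale /= mulrC mulrN mulNr.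
Qed.

Lemma is_derive_sum_pt k (h : 'I_k -> V -> R) q v (dh : 'I_k -> R) :
  (forall i, is_derive q v (h i) (dh i)) ->
  is_derive q v (fun p => \sum_(i < k) h i p) (\sum_(i < k) dh i).
Proof.
move=> hd; have -> : (fun p => \sum_(i < k) h i p) = \sum_(i < k) h i.
  by apply/funext => p; rewrite fct_sumE.
exact: is_derive_sum.
Qed.

Lemma is_derive_comp (g : R -> R) f q v (e d : R) :
  is_derive (f q) 1 g e -> is_derive q v f d ->
  is_derive q v (fun p => g (f p)) (e * d).
Proof.
move=> dg /is_derive_line df; apply/is_derive_line.
apply: (is_derive1_comp (f := g) (g := fun h => f (h *: v + q))) => //.
by rewrite scale0r add0r.
Qed.

End PointwiseRules.

Lemma is_derive_coord (R : realType) (m : nat) (i : 'I_m) (q v : 'rV[R]_m) :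
  is_derive q v (fun p : 'rV[R]_m => p 0 i) (v 0 i).
Proof.
apply/is_derive_line.
have -> : (fun h : R => (h *: v + q) 0 i) = (fun h => h * v 0 i + q 0 i).
  by apply/funext => h; rewrite !mxE.
apply: is_derive_eq; rewrite /GRing.scale /=; ring.
Qed.

(** A coinduction principle for smoothness. The function [g] may differ from the
    member [f] of the family outside [U]; as [U] is open, the partial derivatives
    at points of [U] do not see the difference. *)
Lemma smooth_on_closed (R : realType) (m : nat) (U : set 'rV[R]_m)
    (F : ('rV[R]_m -> R) -> Prop) :
  open U ->
  (forall f, F f -> forall q, U q -> {for q, continuous f}) ->
  (forall f, F f -> forall i : 'I_m, exists2 g, F g &
     forall q, U q -> is_derive q (delta_mx 0 i) f (g q)) ->
  forall f g, F f -> (forall q, U q -> g q = f q) -> smooth_on U g.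
Proof.
move=> oU cF dF f0 f1 Ff0 f1E s.
have [g Fg fg] : exists2 g, F g & forall q, U q -> iter_partial s f1 q = g q.
  elim: s => [|i s [g Fg fg]]; first by exists f0.
  have [h Fh gh] := dF g Fg i; exists h => // q Uq /=.
  rewrite /partial (near_eq_derive (g := g)).
    by have [_ ->] := gh q Uq.
  by apply: filterS (open_nbhs_nbhs (conj oU Uq)) => p; exact: fg.
move=> q Uq; have nfg : \forall p \near q, g p = iter_partial s f1 p.
  by apply: filterS (open_nbhs_nbhs (conj oU Uq)) => p /fg ->.
split.
  have := cF g Fg q Uq; rewrite /prop_for /continuous_at (fg q Uq).
  exact: cvg_trans (near_eq_cvg nfg).
move=> i; have [h _ gh] := dF g Fg i.
by apply: near_eq_derivable nfg _; have [] := gh q Uq.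
Qed.
(** * Polar coordinates on the Heisenberg group *)

Section Polar.
Variables (R : realType) (n : nat).
Implicit Types q v : heis R n.

Definition xnorm2 q : R := \sum_(j < n + n) xcoord q j ^+ 2.

(** The derivative of [xnorm2] at [q] along [v]. *)
Definition dxnorm2 q v : R := 2 * \sum_(j < n + n) xcoord q j * xcoord v j.

(** The common modulus of [heis_v q] and [heis_w q]. *)
Definition vnorm q : R := Num.sqrt (xnorm2 q ^+ 2 + 16 * zcoord q ^+ 2).

(** Half the argument of w, from tan (t / 2) = sin t / (1 + cos t). The
    denominator only vanishes at the origin, so this formula is regular on the
    axis x = 0 too, where the quotient 4 z / r is not defined. *)
Definition half_angle q : R := atan (4 * zcoord q / (vnorm q + xnorm2 q)).

Lemma xnorm2_ge0 q : 0 <= xnorm2 q.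
Proof. by apply: sumr_ge0 => j _; exact: sqr_ge0. Qed.

Lemma vnorm_ge0 q : 0 <= vnorm q.
Proof. exact: sqrtr_ge0. Qed.

Lemma sqr_vnorm q : vnorm q ^+ 2 = xnorm2 q ^+ 2 + 16 * zcoord q ^+ 2.
Proof.
rewrite sqr_sqrtr//.
by have := sqr_ge0 (xnorm2 q); have := sqr_ge0 (zcoord q); lra.
Qed.

Lemma vnorm_gt0 q : q != 0 -> 0 < vnorm q.
Proof.
move=> q0; rewrite lt_def vnorm_ge0 andbT; apply: contra q0 => /eqP N0.
have := sqr_vnorm q; rewrite N0 expr0n/= => /esym E.
have z0 : zcoord q = 0.
  apply/eqP; rewrite -sqrf_eq0 eq_le sqr_ge0 andbT.
  by have := sqr_ge0 (xnorm2 q); lra.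
have x0 : xnorm2 q = 0.
  apply/eqP; rewrite -sqrf_eq0 eq_le sqr_ge0 andbT.
  by have := sqr_ge0 (zcoord q); lra.
apply/eqP/rowP => i; rewrite mxE; case: (split_ordP i) => j ->; last first.
  by rewrite (ord1 j).
have : xcoord q j ^+ 2 = 0.
  by move/psumr_eq0P : x0 => -> // k _; exact: sqr_ge0.
by move/eqP; rewrite sqrf_eq0 => /eqP.
Qed.

Lemma vnormDxnorm2_gt0 q : q != 0 -> 0 < vnorm q + xnorm2 q.
Proof. by move=> q0; rewrite ltr_wpDr ?xnorm2_ge0 ?vnorm_gt0. Qed.

Lemma is_derive_zcoord q v : is_derive q v (@zcoord R n) (zcoord v).
Proof. exact: is_derive_coord. Qed.

Lemma is_derive_xnorm2 q v : is_derive q v xnorm2 (dxnorm2 q v).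
Proof.
apply: is_derive_eq.
  by apply: is_derive_sum_pt => j; apply: is_deriveM_pt; exact: is_derive_coord.
by rewrite /dxnorm2 mulr_sumr; apply: eq_bigr => j _; rewrite /xcoord; ring.
Qed.

Lemma is_derive_vnorm2 q v :
  is_derive q v (fun p => xnorm2 p ^+ 2 + 16 * zcoord p ^+ 2)
    (2 * xnorm2 q * dxnorm2 q v + 32 * zcoord q * zcoord v).
Proof.
apply: is_derive_eq.
  apply: is_deriveD_pt.
    by apply: is_deriveM_pt; exact: is_derive_xnorm2.
  by apply: is_deriveMl_pt; apply: is_deriveM_pt; exact: is_derive_zcoord.
by ring.
Qed.

Lemma is_derive_vnorm q v : q != 0 -> is_derive q v vnorm
  ((xnorm2 q * dxnorm2 q v + 16 * zcoord q * zcoord v) / vnorm q).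
Proof.
move=> q0; have N0 := vnorm_gt0 q0; apply: is_derive_eq.
  apply: is_derive_comp (is_derive_vnorm2 q v).
  by apply: is_derive1_sqrt; rewrite -sqr_vnorm exprn_gt0.
by rewrite -/(vnorm q); field; rewrite gt_eqF.
Qed.

Lemma is_derive_half_ln_vnorm q v : q != 0 ->
  is_derive q v (fun p => 2^-1 * ln (vnorm p))
  ((xnorm2 q * dxnorm2 q v + 16 * zcoord q * zcoord v) / (2 * vnorm q ^+ 2)).
Proof.
move=> q0; have N0 := vnorm_gt0 q0; apply: is_derive_eq.
  apply: is_deriveMl_pt; apply: is_derive_comp (is_derive_vnorm v q0).
  exact: is_derive1_ln.
by field; rewrite gt_eqF.
Qed.

Lemma is_derive_half_angle q v : q != 0 -> is_derive q v half_angle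
  (2 * (xnorm2 q * zcoord v - zcoord q * dxnorm2 q v) / vnorm q ^+ 2).
Proof.
move=> q0; have N0 := vnorm_gt0 q0; have S0 := vnormDxnorm2_gt0 q0.
apply: is_derive_eq.
  apply: (is_derive_comp (g := @atan R)).
  apply: is_deriveM_pt.
    by apply: is_deriveMl_pt; exact: is_derive_zcoord.
  apply: is_deriveV_pt; first by rewrite gt_eqF.
  apply: is_deriveD_pt; first exact: is_derive_vnorm.
  exact: is_derive_xnorm2.
have := sqr_vnorm q.
move: (vnorm q) (xnorm2 q) (zcoord q) (zcoord v) (dxnorm2 q v) N0 S0.
move=> N r z dz dr N0 S0 NE.
have -> : 1 + (4 * z / (N + r)) ^+ 2 = 2 * N / (N + r).
  have -> : (4 * z / (N + r)) ^+ 2 = (N ^+ 2 - r ^+ 2) / (N + r) ^+ 2.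
    by rewrite NE; field; rewrite gt_eqF.
  by field; rewrite gt_eqF.
(* Only N^2 = r^2 + 16 z^2 relates N, r and z: isolate the factor that
   vanishes because of it. *)
have zE : z ^+ 2 = (N ^+ 2 - r ^+ 2) / 16 by rewrite NE; field.
apply/eqP; rewrite -subr_eq0; apply/eqP.
transitivity (dz * ((N ^+ 2 - r ^+ 2) - 16 * z ^+ 2) / (N ^+ 2 * (N + r)) * 2).
  by field; rewrite !gt_eqF.
by rewrite zE; field; rewrite !gt_eqF.
Qed.

End Polar.
(** * The principal branch in polar form *)

Section PolarForm.
Variable R : realType.
Implicit Types z w : R[i].

Lemma imaginaryE : 'i%R = (0 +i* 1)%C :> R[i].
Proof. by []. Qed.

Lemma cexpD z w : cexp (z + w) = cexp z * cexp w.
Proof.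
case: z w => [a b] [c d]; rewrite /cexp /=.
by apply/eqP; rewrite eq_complex /= expRD cosD sinD; apply/andP; split;
  apply/eqP; ring.
Qed.

(** The half-angle formula for the principal argument, valid off the closed
    negative real axis: cos (2 atan t) = (1 - t^2) / (1 + t^2) equals Re z / |z|
    for this t, and 2 atan t has the sign of Im z. *)
Lemma carg_half z : 0 < Normc.normc z + complex.Re z ->
  carg z = 2 * atan (complex.Im z / (Normc.normc z + complex.Re z)).
Proof.
case: z => [a b] /=; rewrite /carg /=.
set c := Num.sqrt _ => S0.
have c2 : c ^+ 2 = a ^+ 2 + b ^+ 2.
  by rewrite sqr_sqrtr//; have := sqr_ge0 a; have := sqr_ge0 b; lra.
have c0 : 0 < c.
  rewrite lt_def sqrtr_ge0 andbT; apply/eqP => c0.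
  have := sqr_ge0 b; move: c2; rewrite c0 expr0n/= => c2 b2.
  have : a ^+ 2 == 0 by rewrite eq_le sqr_ge0 andbT; lra.
  by rewrite sqrf_eq0 => /eqP a0; move: S0; rewrite c0 a0; lra.
set t := b / (c + a).
have ct : a / c = cos (2 * atan t).
  have t2 : 1 + t ^+ 2 = 2 * c / (c + a).
    have -> : t ^+ 2 = (c ^+ 2 - a ^+ 2) / (c + a) ^+ 2.
      by rewrite /t c2; field; rewrite gt_eqF.
    by field; rewrite gt_eqF.
  rewrite mulr_natl cos_mulr2n cos_atan exprVn sqr_sqrtr; last first.
    by have := sqr_ge0 t; lra.
  by rewrite t2 -mulr_natr; field; rewrite !gt_eqF.
have := atan_gtNpi2 t; have := atan_ltpi2 t; rewrite {}ct.
case: ifPn => [b0|]; last rewrite -ltNge => b0.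
- have : 0 <= atan t.
    by rewrite -atan0 le_atan// divr_ge0// ltW.
  by move=> *; rewrite cosK// in_itv/=; apply/andP; split; lra.
- have : atan t <= 0.
    rewrite -[leRHS]atan0; apply: le_atan.
    by rewrite mulr_le0_ge0 ?invr_ge0// ltW.
  by move=> *; rewrite cosKN ?opprK//; apply/andP; split; lra.
Qed.

End PolarForm.

Section SolutionPolarForm.
Variables (R : realType) (n : nat) (L : R).
Implicit Types q : heis R n.

Lemma heis_vE q : heis_v q = (xnorm2 q +i* - (4 * zcoord q))%C.
Proof.
rewrite /heis_v imaginaryE; apply/eqP; rewrite eq_complex /=.
by apply/andP; split; apply/eqP; rewrite /xnorm2; ring.
Qed.

Lemma heis_wE q : heis_w q = (xnorm2 q +i* (4 * zcoord q))%C.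
Proof.
rewrite /heis_w imaginaryE; apply/eqP; rewrite eq_complex /=.
by apply/andP; split; apply/eqP; rewrite /xnorm2; ring.
Qed.

Lemma normc_heis_v q : Normc.normc (heis_v q) = vnorm q.
Proof. by rewrite heis_vE /= /vnorm sqrrN exprMn -natrX. Qed.

Lemma normc_heis_w q : Normc.normc (heis_w q) = vnorm q.
Proof. by rewrite heis_wE /= /vnorm exprMn -natrX. Qed.

Lemma carg_heis_v q : q != 0 -> carg (heis_v q) = - (2 * half_angle q).
Proof.
move=> q0; rewrite carg_half normc_heis_v heis_vE /= ?vnormDxnorm2_gt0//.
by rewrite mulNr atanN mulrN.
Qed.

Lemma carg_heis_w q : q != 0 -> carg (heis_w q) = 2 * half_angle q.
Proof.
by move=> q0; rewrite carg_half normc_heis_w heis_wE /= ?vnormDxnorm2_gt0.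
Qed.

Lemma heis_v_neq0 q : q != 0 -> heis_v q != 0.
Proof.
move=> q0; apply/eqP => v0; have := vnorm_gt0 q0.
by rewrite -normc_heis_v v0 Normc.normc0 ltxx.
Qed.

Lemma heis_w_neq0 q : q != 0 -> heis_w q != 0.
Proof.
move=> q0; apply/eqP => v0; have := vnorm_gt0 q0.
by rewrite -normc_heis_w v0 Normc.normc0 ltxx.
Qed.

(** Modulus and continuous argument of the solution off the origin. The modulus
    is kept as an exponential, the form in which the complex powers produce it. *)
Definition u_mod q : R := expR (2^-1 * ln (vnorm q)).
Definition u_arg q : R := L * half_angle q.

Lemma u_inftyE q : q != 0 ->
  u_infty L q = (u_mod q * cos (u_arg q) +i* (u_mod q * sin (u_arg q)))%C.
Proof.
move=> q0; rewrite /u_infty /cpow (negPf (heis_v_neq0 q0)).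
rewrite (negPf (heis_w_neq0 q0)) -cexpD.
rewrite /clog normc_heis_v normc_heis_w carg_heis_v// carg_heis_w//.
have -> : ((1 - L) / 4)%:C%C * (ln (vnorm q) +i* - (2 * half_angle q))%C +
          ((1 + L) / 4)%:C%C * (ln (vnorm q) +i* (2 * half_angle q))%C
        = (2^-1 * ln (vnorm q) +i* u_arg q)%C.
  apply/eqP; rewrite eq_complex /= /u_arg; apply/andP.
  by split; apply/eqP; field.
apply/eqP; rewrite /cexp eq_complex /= /u_mod.
by apply/andP; split; apply/eqP; ring.
Qed.

Lemma sqr_u_mod q : q != 0 -> u_mod q ^+ 2 = vnorm q.
Proof.
move=> q0; rewrite /u_mod -expRM_natl mulrA divff// mul1r.
by rewrite lnK// posrE vnorm_gt0.
Qed.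

End SolutionPolarForm.
(** * Smoothness away from the origin *)

Section ContinuityRules.
Variables (R : realType) (T : topologicalType).
Implicit Types (f g : T -> R) (q : T).

(** Continuity rules in the same expression form as the differentiation rules. *)
Lemma continuousD_pt f g q : {for q, continuous f} -> {for q, continuous g} ->
  {for q, continuous (fun p => f p + g p)}.
Proof. exact: cvgD. Qed.

Lemma continuousM_pt f g q : {for q, continuous f} -> {for q, continuous g} ->
  {for q, continuous (fun p => f p * g p)}.
Proof. exact: cvgM. Qed.

Lemma continuousMl_pt (c : R) f q : {for q, continuous f} ->
  {for q, continuous (fun p => c * f p)}.
Proof. by move=> cf; apply: continuousM_pt => //; exact: cvg_cst. Qed.

Lemma continuousV_pt f q : f q != 0 -> {for q, continuous f} ->
  {for q, continuous (fun p => (f p)^-1)}.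
Proof. exact: cvgV. Qed.

Lemma continuous_comp_pt (h : R -> R) f q : {for f q, continuous h} ->
  {for q, continuous f} -> {for q, continuous (fun p => h (f p))}.
Proof. by move=> ch cf; exact: continuous_comp cf ch. Qed.

End ContinuityRules.

Section Smoothness.
Variables (R : realType) (n : nat) (L : R).
Implicit Types q v : heis R n.

Definition u_re q : R := u_mod q * cos (u_arg L q).
Definition u_im q : R := u_mod q * sin (u_arg L q).

(** [dlog_mod q v] and [d_arg q v] are the derivatives at [q] along [v] of the
    logarithm of the modulus and of the argument of the solution, off the
    origin. *)
Definition dlog_mod q v : R :=
  (xnorm2 q * dxnorm2 q v + 16 * zcoord q * zcoord v) / (2 * vnorm q ^+ 2).

Definition d_arg q v : R :=
  L * (2 * (xnorm2 q * zcoord v - zcoord q * dxnorm2 q v) / vnorm q ^+ 2).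

Lemma is_derive_u_mod q v : q != 0 ->
  is_derive q v (@u_mod R n) (u_mod q * dlog_mod q v).
Proof.
move=> q0; apply: (is_derive_comp (g := @expR R)).
exact: is_derive_half_ln_vnorm.
Qed.

Lemma is_derive_u_arg q v : q != 0 ->
  is_derive q v (@u_arg R n L) (d_arg q v).
Proof.
by move=> q0; apply: is_deriveMl_pt; exact: is_derive_half_angle.
Qed.

Lemma is_derive_u_re q v : q != 0 ->
  is_derive q v u_re (u_re q * dlog_mod q v - u_im q * d_arg q v).
Proof.
move=> q0; apply: is_derive_eq.
  apply: is_deriveM_pt; first exact: is_derive_u_mod.
  apply: (is_derive_comp (g := @cos R)); exact: is_derive_u_arg.
by rewrite /u_re /u_im; ring.
Qed.

Lemma is_derive_u_im q v : q != 0 ->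
  is_derive q v u_im (u_im q * dlog_mod q v + u_re q * d_arg q v).
Proof.
move=> q0; apply: is_derive_eq.
  apply: is_deriveM_pt; first exact: is_derive_u_mod.
  apply: (is_derive_comp (g := @sin R)); exact: is_derive_u_arg.
by rewrite /u_re /u_im; ring.
Qed.

(** Contains the real and imaginary parts of all partial derivatives of the
    solution: the only denominators that differentiation produces are powers of
    [vnorm q ^+ 2], a polynomial in the coordinates. *)
Inductive u_algebra : (heis R n -> R) -> Prop :=
| ualg_cst c : u_algebra (fun=> c)
| ualg_coord i : u_algebra (fun q => q 0 i)
| ualg_inv : u_algebra (fun q => (vnorm q ^+ 2)^-1)
| ualg_re : u_algebra u_re
| ualg_im : u_algebra u_im
| ualgD f g : u_algebra f -> u_algebra g -> u_algebra (fun q => f q + g q)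
| ualgM f g : u_algebra f -> u_algebra g -> u_algebra (fun q => f q * g q).

Lemma ualg_sum k (F : 'I_k -> heis R n -> R) :
  (forall j, u_algebra (F j)) -> u_algebra (fun q => \sum_(j < k) F j q).
Proof.
elim: k F => [|k IH] F FA.
  have -> : (fun q => \sum_(j < 0) F j q) = (fun=> 0).
    by apply/funext => q; rewrite big_ord0.
  exact: ualg_cst.
have -> : (fun q => \sum_(j < k.+1) F j q) =
    (fun q => F ord0 q + \sum_(j < k) F (lift ord0 j) q).
  by apply/funext => q; rewrite big_ord_recl.
by apply: ualgD => //; apply: IH.
Qed.

Lemma ualgMl c f : u_algebra f -> u_algebra (fun q => c * f q).
Proof. by move=> fA; apply: ualgM fA; exact: ualg_cst. Qed.

Lemma ualgN f : u_algebra f -> u_algebra (fun q => - f q).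
Proof.
move=> fA; have -> : (fun q => - f q) = (fun q => -1 * f q).
  by apply/funext => q; rewrite mulN1r.
exact: ualgMl.
Qed.

Lemma ualg_xnorm2 : u_algebra (@xnorm2 R n).
Proof. by apply: ualg_sum => j; apply: ualgM; exact: ualg_coord. Qed.

Lemma ualg_dxnorm2 v : u_algebra (fun q => dxnorm2 q v).
Proof.
apply/ualgMl/ualg_sum => j; apply: ualgM; first exact: ualg_coord.
exact: ualg_cst.
Qed.

Lemma ualg_dlog_mod v : u_algebra (fun q => dlog_mod q v).
Proof.
have -> : (fun q => dlog_mod q v) = (fun q => (vnorm q ^+ 2)^-1 *
    (2^-1 * (xnorm2 q * dxnorm2 q v + 16 * (q 0 (zidx n) * zcoord v)))).
  by apply/funext => q; rewrite /dlog_mod invfM /zcoord; ring.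
apply: ualgM ualg_inv _; apply: ualgMl; apply: ualgD.
  exact: ualgM ualg_xnorm2 (ualg_dxnorm2 v).
exact/ualgMl/ualgM/ualg_cst/ualg_coord.
Qed.

Lemma ualg_d_arg v : u_algebra (fun q => d_arg q v).
Proof.
have -> : (fun q => d_arg q v) = (fun q => (vnorm q ^+ 2)^-1 *
    (2 * L * (xnorm2 q * zcoord v + - (q 0 (zidx n) * dxnorm2 q v)))).
  by apply/funext => q; rewrite /d_arg /zcoord; ring.
apply: ualgM ualg_inv _; apply: ualgMl; apply: ualgD.
  exact: ualgM ualg_xnorm2 (ualg_cst _).
apply: ualgN; apply: ualgM (ualg_dxnorm2 v); exact: ualg_coord.
Qed.

(** Only the generators require an argument; for Re u and Im u it is
    du = u (d ln |u| + i d arg u), whose second factor is in the algebra. *)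
Lemma ualg_derive f v : u_algebra f -> exists2 g, u_algebra g &
  forall q, q != 0 -> is_derive q v f (g q).
Proof.
elim=> {f} [c|i||||f g fA [f' f'A df] gA [g' g'A dg]
          |f g fA [f' f'A df] gA [g' g'A dg]].
- exists (fun=> 0); first exact: ualg_cst.
  by move=> q _; exact: is_derive_cst.
- exists (fun=> v 0 i); first exact: ualg_cst.
  by move=> q _; exact: is_derive_coord.
- exists (fun q => -4 * ((vnorm q ^+ 2)^-1 * dlog_mod q v)).
    apply/ualgMl/ualgM; [exact: ualg_inv|exact: ualg_dlog_mod].
  move=> q q0; have N0 := vnorm_gt0 q0; apply: is_derive_eq.
    apply: is_deriveV_pt; first by rewrite sqrf_eq0 gt_eqF.
    apply: is_deriveM_pt; exact: is_derive_vnorm.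
  by rewrite /dlog_mod; field; rewrite gt_eqF.
- exists (fun q => u_re q * dlog_mod q v + - (u_im q * d_arg q v)).
    apply: ualgD; first exact: ualgM ualg_re (ualg_dlog_mod v).
    exact: ualgN (ualgM ualg_im (ualg_d_arg v)).
  by move=> q; exact: is_derive_u_re.
- exists (fun q => u_im q * dlog_mod q v + u_re q * d_arg q v).
    apply: ualgD; first exact: ualgM ualg_im (ualg_dlog_mod v).
    exact: ualgM ualg_re (ualg_d_arg v).
  by move=> q; exact: is_derive_u_im.
- exists (fun q => f' q + g' q); first exact: ualgD.
  by move=> q q0; apply: is_deriveD_pt; [exact: df|exact: dg].
- exists (fun q => f q * g' q + g q * f' q); first by apply: ualgD; exact: ualgM.
  by move=> q q0; apply: is_deriveM_pt; [exact: df|exact: dg].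
Qed.

Lemma continuous_coord i q : {for q, continuous (fun p : heis R n => p 0 i)}.
Proof. exact: coord_continuous. Qed.

Lemma continuous_xnorm2 q : {for q, continuous (@xnorm2 R n)}.
Proof.
apply: continuous_big => [|j _ {}q]; first exact: add_continuous.
by apply: continuousM_pt; exact: continuous_coord.
Qed.

Lemma continuous_vnorm q : {for q, continuous (@vnorm R n)}.
Proof.
apply: (continuous_comp_pt (h := Num.sqrt)); first exact: sqrt_continuous.
apply: continuousD_pt; first by apply: continuousM_pt; exact: continuous_xnorm2.
by apply/continuousMl_pt/continuousM_pt; exact: continuous_coord.
Qed.

Lemma continuous_half_angle q : q != 0 -> {for q, continuous (@half_angle R n)}.
Proof.
move=> q0; apply: (continuous_comp_pt (h := @atan R)).
  exact: continuous_atan.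
apply: continuousM_pt; first exact/continuousMl_pt/continuous_coord.
apply: continuousV_pt; first by rewrite gt_eqF// vnormDxnorm2_gt0.
by apply: continuousD_pt; [exact: continuous_vnorm|exact: continuous_xnorm2].
Qed.

Lemma continuous_u_mod q : q != 0 -> {for q, continuous (@u_mod R n)}.
Proof.
move=> q0; apply: (continuous_comp_pt (h := @expR R)).
  exact: continuous_expR.
apply: continuousMl_pt.
apply: (continuous_comp_pt (h := @ln R)); last exact: continuous_vnorm.
exact/continuous_ln/vnorm_gt0.
Qed.

Lemma continuous_u_arg q : q != 0 -> {for q, continuous (@u_arg R n L)}.
Proof. by move=> q0; exact/continuousMl_pt/continuous_half_angle. Qed.

Lemma ualg_continuous f q : u_algebra f -> q != 0 -> {for q, continuous f}.
Proof.
move=> fA q0; elim: fA => {f} [c|i||||f g _ fc _ gc|f g _ fc _ gc].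
- exact: (@cst_continuous (heis R n) R c q).
- exact: continuous_coord.
- apply: continuousV_pt; first by rewrite sqrf_eq0 gt_eqF ?vnorm_gt0.
  by apply: continuousM_pt; exact: continuous_vnorm.
- apply: continuousM_pt; first exact: continuous_u_mod.
  apply: (continuous_comp_pt (h := @cos R)); first exact: continuous_cos.
  exact: continuous_u_arg.
- apply: continuousM_pt; first exact: continuous_u_mod.
  apply: (continuous_comp_pt (h := @sin R)); first exact: continuous_sin.
  exact: continuous_u_arg.
- exact: continuousD_pt.
- exact: continuousM_pt.
Qed.

Lemma open_neq0 : open (~` [set 0 : heis R n]).
Proof.
rewrite openC; apply/accessible_closed_set1/hausdorff_accessible.
exact: norm_hausdorff.
Qed.

Lemma smooth_on_ualg f g : u_algebra f -> (forall q, q != 0 -> g q = f q) ->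
  smooth_on (~` [set 0]) g.
Proof.
move=> fA gf; apply: (smooth_on_closed open_neq0) (fA) _
  => [{fA gf}f fA|{fA gf}f fA|].
- by move=> q /eqP; exact: ualg_continuous.
- move=> i; have [h hA dh] := ualg_derive (delta_mx 0 i) fA.
  by exists h => // q /eqP; exact: dh.
- by move=> q /eqP; exact: gf.
Qed.

Lemma csmooth_u_infty : csmooth_on (~` [set 0 : heis R n]) (u_infty L).
Proof.
split; [apply: smooth_on_ualg ualg_re _|apply: smooth_on_ualg ualg_im _] => q q0;
  by rewrite u_inftyE.
Qed.

End Smoothness.
(** * The infinity-Laplace equation *)

(** Stated for near equality because the closed formulas for the solution and for
    the squared norm of Upsilon hold off the origin only. *)
Lemma cpartial_eq_near (R : realType) (m : nat) (i : 'I_m)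
    (f : 'rV[R]_m -> R[i]) (g h : 'rV[R]_m -> R) (q : 'rV[R]_m) (a b : R) :
  (\forall p \near q, f p = (g p +i* h p)%C) ->
  is_derive q (delta_mx 0 i) g a -> is_derive q (delta_mx 0 i) h b ->
  cpartial i f q = (a +i* b)%C.
Proof.
move=> fE dg dh; rewrite /cpartial /partial.
rewrite (near_eq_derive (g := g)); last by apply: (filterS _ fE) => p /= ->.
rewrite (near_eq_derive (f := fun p => complex.Im (f p)) (g := h)); last first.
  by apply: (filterS _ fE) => p /= ->.
by case: dg => _ ->; case: dh => _ ->.
Qed.

Section HorizontalDerivatives.
Variables (R : realType) (n : nat).
Implicit Types (q : heis R n) (f : heis R n -> R[i]) (L : R) (k : 'I_n).

Lemma split_lshift k : fintype.split (lshift n k) = inl k.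
Proof. exact: (unsplitK (inl k)). Qed.

Lemma split_rshift k : fintype.split (rshift n k) = inr k.
Proof. exact: (unsplitK (inr k)). Qed.

Lemma heisX_lshift k f q : heisX (lshift n k) f q =
  cpartial (xidx (lshift n k)) f q
  - (xcoord q (rshift n k) / 2)%:C%C * cpartial (zidx n) f q.
Proof. by rewrite /heisX split_lshift. Qed.

Lemma heisX_rshift k f q : heisX (rshift n k) f q =
  cpartial (xidx (rshift n k)) f q
  + (xcoord q (lshift n k) / 2)%:C%C * cpartial (zidx n) f q.
Proof. by rewrite /heisX split_rshift. Qed.

Lemma Upsilon_lshift L k f q : Upsilon L f (lshift n k) q =
  heisX (lshift n k) f q + 'i * L%:C%C * heisX (rshift n k) f q.
Proof. by rewrite /Upsilon split_lshift. Qed.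

Lemma Upsilon_rshift L k f q : Upsilon L f (rshift n k) q =
  heisX (rshift n k) f q - 'i * L%:C%C * heisX (lshift n k) f q.
Proof. by rewrite /Upsilon split_rshift. Qed.

Lemma xcoord_delta_x j l :
  xcoord (delta_mx 0 (xidx j) : heis R n) l = (l == j)%:R.
Proof. by rewrite /xcoord mxE eqxx (inj_eq (@lshift_inj _ _)). Qed.

Lemma xcoord_delta_z l : xcoord (delta_mx 0 (zidx n) : heis R n) l = 0.
Proof. by rewrite /xcoord mxE eqxx eq_lrshift. Qed.

Lemma zcoord_delta_x j : zcoord (delta_mx 0 (xidx j) : heis R n) = 0.
Proof. by rewrite /zcoord mxE eqxx eq_rlshift. Qed.

Lemma zcoord_delta_z : zcoord (delta_mx 0 (zidx n) : heis R n) = 1.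
Proof. by rewrite /zcoord mxE !eqxx. Qed.

Lemma dxnorm2_delta_x j q : dxnorm2 q (delta_mx 0 (xidx j)) = 2 * xcoord q j.
Proof.
rewrite /dxnorm2 (bigD1 j)//= xcoord_delta_x eqxx mulr1 big1 ?addr0// => l lj.
by rewrite xcoord_delta_x (negPf lj) mulr0.
Qed.

Lemma dxnorm2_delta_z q : dxnorm2 q (delta_mx 0 (zidx n)) = 0.
Proof.
by rewrite /dxnorm2 big1 ?mulr0// => l _; rewrite xcoord_delta_z mulr0.
Qed.

Definition delta_coordE := (dxnorm2_delta_x, dxnorm2_delta_z, zcoord_delta_x,
  zcoord_delta_z).

End HorizontalDerivatives.

Lemma mulr_conj_real (R : realType) (c : R) (z : R[i]) :
  c%:C%C * z * (c%:C%C * z)^* = (c ^+ 2)%:C%C * (z * z^*).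
Proof.
rewrite -[(c%:C%C * z)^*]/(conjc (c%:C%C * z)) -[z^*]/(conjc z).
case: z => a b; apply/eqP; rewrite eq_complex /=.
by apply/andP; split; apply/eqP; ring.
Qed.

Section Equation.
Variables (R : realType) (n : nat) (L : R).
Implicit Types (q : heis R n) (k : 'I_n).

(** [wx_re k q] and [wx_im k q] are the real and imaginary parts of
    w (x_k + i x_(n+k)). *)
Definition wx_re k q : R :=
  xnorm2 q * xcoord q (lshift n k) - 4 * zcoord q * xcoord q (rshift n k).

Definition wx_im k q : R :=
  xnorm2 q * xcoord q (rshift n k) + 4 * zcoord q * xcoord q (lshift n k).

Definition u_val q : R[i] := (u_re L q +i* u_im L q)%C.

Lemma near_neq0 q : q != 0 -> \forall p \near q, p != 0.
Proof.
move=> /eqP q0; have := open_nbhs_nbhs (conj (@open_neq0 R n) q0).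
by apply: filterS => p /eqP.
Qed.

Lemma cpartial_u_infty i q : q != 0 -> cpartial i (u_infty L) q =
  u_val q * (dlog_mod q (delta_mx 0 i) +i* d_arg L q (delta_mx 0 i))%C.
Proof.
move=> q0; rewrite (cpartial_eq_near _ (is_derive_u_re L _ q0)
                                       (is_derive_u_im L _ q0)).
  by apply/eqP; rewrite eq_complex /=; apply/andP; split; apply/eqP; ring.
by apply: filterS (near_neq0 q0) => p; exact: u_inftyE.
Qed.

(** X_k u = u (wx_re - i L wx_im) / N^2 and X_(n+k) u = u (wx_im + i L wx_re) / N^2,
    so the terms in i L cancel in both components of Upsilon and what multiplies
    u is real. *)
Lemma Upsilon_u_lshift k q : q != 0 -> Upsilon L (u_infty L) (lshift n k) q =
  ((1 - L ^+ 2) * wx_re k q / vnorm q ^+ 2)%:C%C * u_val q.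
Proof.
move=> q0; rewrite Upsilon_lshift heisX_lshift heisX_rshift.
rewrite !cpartial_u_infty// /dlog_mod /d_arg !delta_coordE imaginaryE.
rewrite /wx_re; have := vnorm_gt0 q0; rewrite /u_val.
move: (vnorm q) (u_re L q) (u_im L q) => N A B N0.
apply/eqP; rewrite eq_complex /=.
by apply/andP; split; apply/eqP; field; rewrite gt_eqF.
Qed.

Lemma Upsilon_u_rshift k q : q != 0 -> Upsilon L (u_infty L) (rshift n k) q =
  ((1 - L ^+ 2) * wx_im k q / vnorm q ^+ 2)%:C%C * u_val q.
Proof.
move=> q0; rewrite Upsilon_rshift heisX_lshift heisX_rshift.
rewrite !cpartial_u_infty// /dlog_mod /d_arg !delta_coordE imaginaryE.
rewrite /wx_im; have := vnorm_gt0 q0; rewrite /u_val.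
move: (vnorm q) (u_re L q) (u_im L q) => N A B N0.
apply/eqP; rewrite eq_complex /=.
by apply/andP; split; apply/eqP; field; rewrite gt_eqF.
Qed.

Lemma u_val_conj q : q != 0 -> u_val q * (u_val q)^* = (vnorm q)%:C%C.
Proof.
move=> q0; rewrite -sqr_u_mod//.
transitivity (((u_mod q ^+ 2) *
  (cos (u_arg L q) ^+ 2 + sin (u_arg L q) ^+ 2))%:C%C : R[i]).
  rewrite -[(_)^*]/(conjc (u_val q)) /u_val /u_re /u_im.
  by apply/eqP; rewrite eq_complex /=; apply/andP; split; apply/eqP; ring.
by rewrite cos2Dsin2 mulr1.
Qed.

(** Multiplicativity of the modulus: |w (x_k + i x_(n+k))|^2. *)
Lemma wx_normsq k q : wx_re k q ^+ 2 + wx_im k q ^+ 2 =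
  (xcoord q (lshift n k) ^+ 2 + xcoord q (rshift n k) ^+ 2) * vnorm q ^+ 2.
Proof. by rewrite sqr_vnorm /wx_re /wx_im; ring. Qed.

Lemma sqnorm_Upsilon_u q : q != 0 -> sqnorm_Upsilon L (u_infty L) q =
  ((1 - L ^+ 2) ^+ 2 * (xnorm2 q / vnorm q))%:C%C.
Proof.
move=> q0; have N0 := vnorm_gt0 q0; have UU := u_val_conj q0.
have term (c : R) : c%:C%C * u_val q * (c%:C%C * u_val q)^* =
    (c ^+ 2 * vnorm q)%:C%C.
  by rewrite mulr_conj_real UU -rmorphM.
rewrite /sqnorm_Upsilon big_split_ord /= -big_split /=.
transitivity (\sum_(k < n) ((1 - L ^+ 2) ^+ 2 / vnorm q *
   (xcoord q (lshift n k) ^+ 2 + xcoord q (rshift n k) ^+ 2))%:C%C : R[i]).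
  apply: eq_bigr => k _; rewrite Upsilon_u_lshift// Upsilon_u_rshift// !term.
  rewrite -rmorphD; congr (_%:C)%C.
  transitivity ((1 - L ^+ 2) ^+ 2 * (wx_re k q ^+ 2 + wx_im k q ^+ 2) /
     vnorm q ^+ 3); first by field; rewrite gt_eqF.
  by rewrite wx_normsq; field; rewrite gt_eqF.
rewrite -rmorph_sum -mulr_sumr big_split /=.
by congr (_%:C)%C; rewrite /xnorm2 big_split_ord /=; ring.
Qed.

(** The factor [zcoord q] appears because
    d (r / N) = ((N^2 - r^2) dr - 16 r z dz) / N^3 and N^2 - r^2 = 16 z^2. *)
Lemma is_derive_xnorm2_vnorm q v : q != 0 ->
  is_derive q v (fun p => (1 - L ^+ 2) ^+ 2 * (xnorm2 p / vnorm p))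
   ((1 - L ^+ 2) ^+ 2 * 16 * zcoord q *
    (zcoord q * dxnorm2 q v - xnorm2 q * zcoord v) / vnorm q ^+ 3).
Proof.
move=> q0; have N0 := vnorm_gt0 q0; apply: is_derive_eq.
  apply: is_deriveMl_pt; apply: is_deriveM_pt; first exact: is_derive_xnorm2.
  by apply: is_deriveV_pt; [rewrite gt_eqF|exact: is_derive_vnorm].
transitivity ((1 - L ^+ 2) ^+ 2 * ((vnorm q ^+ 2 - xnorm2 q ^+ 2) * dxnorm2 q v
   - 16 * xnorm2 q * zcoord q * zcoord v) / vnorm q ^+ 3).
  by field; rewrite gt_eqF.
by rewrite sqr_vnorm; field; rewrite gt_eqF.
Qed.

Lemma cpartial_sqnorm i q : q != 0 ->
  cpartial i (sqnorm_Upsilon L (u_infty L)) q =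
  ((1 - L ^+ 2) ^+ 2 * 16 * zcoord q * (zcoord q * dxnorm2 q (delta_mx 0 i)
     - xnorm2 q * zcoord (delta_mx 0 i : heis R n)) / vnorm q ^+ 3)%:C%C.
Proof.
move=> q0; apply: (cpartial_eq_near (h := fun=> 0) _
  (is_derive_xnorm2_vnorm _ q0) (is_derive_cst _ _ _)).
by apply: filterS (near_neq0 q0) => p; exact: sqnorm_Upsilon_u.
Qed.

(** Together with [heisX_sqnorm_rshift]: in each plane (x_k, x_(n+k)) the
    gradient of the squared norm is proportional to (wx_im, - wx_re), hence
    orthogonal to Upsilon, which is proportional to (wx_re, wx_im). *)
Lemma heisX_sqnorm_lshift k q : q != 0 ->
  heisX (lshift n k) (sqnorm_Upsilon L (u_infty L)) q =
  (8 * (1 - L ^+ 2) ^+ 2 * zcoord q * wx_im k q / vnorm q ^+ 3)%:C%C.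
Proof.
move=> q0; have N0 := vnorm_gt0 q0.
rewrite heisX_lshift !cpartial_sqnorm// !delta_coordE -rmorphM -rmorphB.
by congr (_%:C)%C; rewrite /wx_im; field; rewrite gt_eqF.
Qed.

Lemma heisX_sqnorm_rshift k q : q != 0 ->
  heisX (rshift n k) (sqnorm_Upsilon L (u_infty L)) q =
  (- (8 * (1 - L ^+ 2) ^+ 2 * zcoord q * wx_re k q / vnorm q ^+ 3))%:C%C.
Proof.
move=> q0; have N0 := vnorm_gt0 q0.
rewrite heisX_rshift !cpartial_sqnorm// !delta_coordE -rmorphM -rmorphD.
by congr (_%:C)%C; rewrite /wx_re; field; rewrite gt_eqF.
Qed.

Lemma Delta_infty_u q : q != 0 -> Delta_infty L (u_infty L) q = 0.
Proof.
move=> q0; rewrite /Delta_infty big_split_ord /= -big_split big1//= => k _.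
rewrite heisX_sqnorm_lshift// heisX_sqnorm_rshift//.
rewrite Upsilon_u_lshift// Upsilon_u_rshift//.
case: (u_val q) => a b; apply/eqP; rewrite eq_complex /=.
by apply/andP; split; apply/eqP; ring.
Qed.

End Equation.

(** * Boundary value at the origin *)

(** |u|^2 = N is continuous and vanishes at the origin. *)
Lemma u_infty_cvg0 (R : realType) (n : nat) (L : R) :
  u_infty L q @[q --> (0 : heis R n)^'] --> (0 : R[i]^o).
Proof.
(* The norm of R[i] takes values in R[i]; a positive bound there is real. *)
apply: (iffRL (@cvgr0Pnorm_lt R[i] R[i]^o _ _ _ _)) => e e0.
have [eI eR] : complex.Im e = 0 /\ 0 < complex.Re e.
  by move: e0; rewrite ltcE /= => /andP[/eqP].
have N0 : vnorm (0 : heis R n) = 0.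
  have z0 : zcoord (0 : heis R n) = 0 by rewrite /zcoord mxE.
  have x0 : xnorm2 (0 : heis R n) = 0.
    by apply: big1 => j _; rewrite /xcoord mxE expr0n.
  by rewrite /vnorm x0 z0 expr0n/= mulr0 addr0 sqrtr0.
have N1 : \forall q \near (0 : heis R n), vnorm q < complex.Re e ^+ 2.
  have := @continuous_vnorm R n 0.
  by move/cvgr_lt; apply; rewrite N0 exprn_gt0.
apply: filterS N1 => q Nq q0; rewrite u_inftyE//.
rewrite normc_def ltcE /= eI eqxx /= !exprMn -mulrDr cos2Dsin2 mulr1.
rewrite sqr_u_mod//.
have -> : complex.Re e = Num.sqrt (complex.Re e ^+ 2).
  by rewrite sqrtr_sqr gtr0_norm.
by rewrite ltr_sqrt// exprn_gt0.
Qed.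

Theorem theorem6p2 (R : realType) (n : nat) (hn : (1 <= n)%N) (L : R) :
  [/\ csmooth_on (~` [set 0 : heis R n]) (u_infty L),
      forall q : heis R n, q != 0 -> Delta_infty L (u_infty L) q = 0
    & u_infty L q @[q --> (0 : heis R n)^'] --> (0 : R[i]^o)].
Proof.
split; first exact: csmooth_u_infty.
- by move=> q; exact: Delta_infty_u.
- exact: u_infty_cvg0.
Qed.
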